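(* (Stability of latent dynamics models.) Fix $\boldsymbol{\mu}\in\mathcal{P}$. Let $\Psi:\mathbb{R}^{N_h}\to\mathbb{R}^n$ and $\Psi':\mathbb{R}^n\to\mathbb{R}^{N_h}$ be Lipschitz continuous, and let $\mathbf{f}_n(t,\cdot;\boldsymbol{\mu})$ be Lipschitz continuous uniformly in $t$ with constant $Lip(\mathbf{f}_n)$. Consider the latent dynamics model $$\tilde{\mathbf{u}}_h(t)=\Psi'(\mathbf{u}_n(t)),\quad\dot{\mathbf{u}}_n(t)=\mathbf{f}_n(t,\mathbf{u}_n(t);\boldsymbol{\mu}),\ t\in(t_0,T],\quad\mathbf{u}_n(t_0)=\Psi(\mathbf{u}_{0,h}(\boldsymbol{\mu})),$$ and its perturbation $$\tilde{\mathbf{z}}_h(t)=\Psi'(\mathbf{z}_n(t)),\quad\dot{\mathbf{z}}_n(t)=\mathbf{f}_n(t,\mathbf{z}_n(t);\boldsymbol{\mu})+\boldsymbol{\delta}(t),\ t\in(t_0,T],\quad\mathbf{z}_n(t_0)=\Psi(\mathbf{u}_{0,h}(\boldsymbol{\mu})+\boldsymbol{\delta}_0),$$ where $\boldsymbol{\delta}_0\in\mathbb{R}^{N_h}$ and $\boldsymbol{\delta}(t)\in\mathbb{R}^n$ satisfy $\|\boldsymbol{\delta}_0\|<\varepsilon$ and $\|\boldsymbol{\delta}(t)\|<\varepsilon$ for all $t\in(t_0,T]$, with $\varepsilon>0$ such that the perturbed latent initial value problem is well-defined on $[t_0,T]$. Then $$\|\tilde{\mathbf{z}}_h(t)-\tilde{\mathbf{u}}_h(t)\|\le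 C\varepsilon\quad\forall t\in(t_0,T],\qquad C=Lip(\Psi')\,\big(Lip(\Psi)+|T-t_0|\big)\,e^{Lip(\mathbf{f}_n)|T-t_0|},$$ with $C$ independent of $\varepsilon$.
   Context: $\mathcal{P}\subset\mathbb{R}^{n_\mu}$ is a compact parameter set, $\mathbf{u}_{0,h}(\boldsymbol{\mu})\in\mathbb{R}^{N_h}$ is the initial value of the full-order model, $n\ll N_h$, $\|\cdot\|$ is the Euclidean norm, and $Lip(\cdot)$ denotes a Lipschitz constant (for $\mathbf{f}_n$: with respect to its second argument, uniformly in $t$). The latent vector field $\mathbf{f}_n:(t_0,T]\times\mathbb{R}^n\times\mathcal{P}\to\mathbb{R}^n$ is continuous and bounded, and the solutions $\mathbf{u}_n,\mathbf{z}_n$ are $C^1$ in time on $[t_0,T]$. *)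

(* Defs.v *)
From mathcomp Require Import all_boot all_order all_algebra.
From mathcomp Require Import all_classical all_reals all_analysis.

Set Implicit Arguments.
Unset Strict Implicit.
Unset Printing Implicit Defensive.
Import Order.TTheory GRing.Theory Num.Theory.
Import numFieldNormedType.Exports.

Local Open Scope classical_set_scope.
Local Open Scope ring_scope.

(* The norm [`|x|] that MathComp-Analysis puts on row vectors is the sup norm;
   it induces the same topology as [enorm] but different Lipschitz constants. *)
Definition enorm (R : realType) (m : nat) (x : 'rV[R]_m) : R :=
  Num.sqrt (\sum_(i < m) x ord0 i ^+ 2).

(* [L] is a (not necessarily the smallest) global Lipschitz constant of [g]. *)
Definition lip_const (R : realType) (m p : nat) (L : R)
    (g : 'rV[R]_m -> 'rV[R]_p) : Prop :=
  0 <= L /\ forall x y, enorm (g x - g y) <= L * enorm (x - y).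

(* The derivative relative to [A]: two-sided at interior points of an interval
   [A], one-sided at those of its endpoints that belong to it. *)
Definition is_derive_within (R : realType) (m : nat) (A : set R)
    (u : R -> 'rV[R]_m) (t : R) (d : 'rV[R]_m) : Prop :=
  (s - t)^-1 *: (u s - u t) @[s --> within A t^'] --> d.

Definition C1_on (R : realType) (m : nat) (a b : R)
    (u : R -> 'rV[R]_m) : Prop :=
  exists du : R -> 'rV[R]_m,
    {within `[a, b], continuous du} /\
    forall t, t \in `[a, b] -> is_derive_within `[a, b] u t (du t).

(* The equation is imposed on ]t0, T] only: at t0 the vector field is given no
   meaning, and [u] is just required to be C^1 up to t0. *)
Definition ivp_solution (R : realType) (m : nat) (t0 T : R)
    (F : R -> 'rV[R]_m -> 'rV[R]_m) (x0 : 'rV[R]_m)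
    (u : R -> 'rV[R]_m) : Prop :=
  [/\ C1_on t0 T u,
      forall t, t \in `]t0, T] -> is_derive_within `[t0, T] u t (F t (u t))
    & u t0 = x0].

(* Main.v *)
Require Import Defs.
From mathcomp Require Import all_boot all_order all_algebra.
From mathcomp Require Import all_classical all_reals all_analysis.
From mathcomp Require Import ring lra.
Import Order.TTheory GRing.Theory Num.Theory.
Import numFieldNormedType.Exports.
Local Open Scope classical_set_scope.
Local Open Scope ring_scope.

(** The error [w := zn - un] solves [w' = fn t zn - fn t un + delta], so by the
    Cauchy-Schwarz inequality, the Lipschitz bound on [fn] and the bound on
    [delta], its Euclidean inner product with its own derivative satisfies
    [<w, w'> <= |w| (Lf |w| + eps)]: formally, [|w|' <= Lf |w| + eps].  A
    Gronwall argument then gives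
    [|w t| <= (|w t0| + eps (t - t0)) exp (Lf (t - t0))], where
    [|w t0| <= LPsi eps] by the Lipschitz bound on [Psi], and the Lipschitz
    bound on [Psi'] transfers this estimate to the reconstructed states.

    Two points need care.  The Euclidean norm is not differentiable at [0], so
    Gronwall's inequality is applied to [sqrt (|w|^2 + eta^2)] and [eta > 0] is
    then made arbitrarily small ([enorm_gronwall]).  The equation holds on
    ]t0, T] only, so instead of integrating it, [ler_gronwall] shows that an
    explicit function is nonincreasing from the sign of its derivative on the
    open interval and its continuity on the closed one.  These two facts are
    obtained, coordinate by coordinate, from the relative derivative
    [is_derive_within]. *)

(** * The Euclidean norm *)

Lemma sumr_sqr_ge0 (R : realDomainType) (m : nat) (x : 'rV[R]_m) :
  0 <= \sum_(i < m) x ord0 i ^+ 2.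
Proof. by apply: sumr_ge0 => i _; exact: sqr_ge0. Qed.

Lemma enorm_ge0 (R : realType) (m : nat) (x : 'rV[R]_m) : 0 <= enorm x.
Proof. exact: sqrtr_ge0. Qed.

Lemma enorm_sqr (R : realType) (m : nat) (x : 'rV[R]_m) :
  enorm x ^+ 2 = \sum_(i < m) x ord0 i ^+ 2.
Proof. by rewrite sqr_sqrtr// sumr_sqr_ge0. Qed.

(** Cauchy-Schwarz, from Lagrange's identity: the double sum of the squares of
    the 2x2 minors of [x] and [y] equals [2 (|x|^2 |y|^2 - <x, y>^2)]. *)
Lemma dotmul_le_enorm (R : realType) (m : nat) (x y : 'rV[R]_m) :
  \sum_(i < m) x ord0 i * y ord0 i <= enorm x * enorm y.
Proof.
rewrite /enorm -sqrtrM ?sumr_sqr_ge0//.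
set p := (\sum_(i < m) x ord0 i * y ord0 i).
apply: le_trans (ler_norm p) _; rewrite -sqrtr_sqr ler_wsqrtr//.
have : 0 <= \sum_(i < m) \sum_(j < m)
    (x ord0 i * y ord0 j - x ord0 j * y ord0 i) ^+ 2.
  by apply: sumr_ge0 => i _; apply: sumr_ge0 => j _; exact: sqr_ge0.
set X := (\sum_(i < m) x ord0 i ^+ 2); set Y := (\sum_(i < m) y ord0 i ^+ 2).
suff -> : \sum_(i < m) \sum_(j < m)
    (x ord0 i * y ord0 j - x ord0 j * y ord0 i) ^+ 2
    = (X * Y - p ^+ 2) *+ 2.
  by rewrite pmulrn_lge0// subr_ge0.
transitivity (\sum_(i < m) (x ord0 i ^+ 2 * Y - x ord0 i * y ord0 i * p *+ 2
   + X * y ord0 i ^+ 2)).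
  apply: eq_bigr => i _; rewrite /X /Y /p.
  rewrite mulr_sumr mulr_suml mulr_sumr -sumrMnl -sumrB -big_split/=.
  by apply: eq_bigr => j _; ring.
rewrite big_split/= sumrB -mulr_suml sumrMnl -mulr_suml -mulr_sumr.
by rewrite -/X -/Y -/p; ring.
Qed.

(** * Derivatives relative to a set, by coordinates *)

Lemma is_derive_within_coord (R : realType) (m : nat) (A : set R)
    (u : R -> 'rV[R]_m) (t : R) (d : 'rV[R]_m) (i : 'I_m) :
  is_derive_within A u t d ->
  (s - t)^-1 * (u s ord0 i - u t ord0 i) @[s --> within A t^'] --> d ord0 i.
Proof.
move=> ud.
have := cvg_comp _ _ ud (@coord_continuous _ _ _ ord0 i d).
apply: cvg_trans; apply: near_eq_cvg; near=> s.
by rewrite /= !mxE.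
Unshelve. all: by end_near. Qed.

Lemma shift_dnbhs (R : realType) (t : R) : (h + t) @[h --> 0^'] --> t^'.
Proof.
move=> /= P; rewrite /dnbhs/= /within/= !near_simpl => /nbhs_ballP[e e0 tP].
apply/nbhs_ballP; exists e => //= h /= h0 hN0; apply: tP.
  by move: h0; rewrite /ball/= sub0r normrN opprD addrCA subrr addr0 normrN.
by rewrite -subr_eq0 addrK.
Qed.

(** At an interior point of [A] the restriction to [A] does not change the
    punctured neighbourhoods, and the substitution [s = h + t] turns the
    quotient at [t] into the increment quotient in [h] that defines
    [is_derive]. *)
Lemma is_derive_within_interior (R : realType) (m : nat) (A : set R)
    (u : R -> 'rV[R]_m) (t : R) (d : 'rV[R]_m) (i : 'I_m) : A° t ->
  is_derive_within A u t d -> is_derive t 1 (fun s => u s ord0 i) (d ord0 i).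
Proof.
move=> At /(is_derive_within_coord _ _ _ _ _ _ i) ud.
have {}ud : (s - t)^-1 * (u s ord0 i - u t ord0 i) @[s --> t^'] --> d ord0 i.
  apply: cvg_trans ud; apply: cvg_app => P.
  rewrite /dnbhs /within/= !near_simpl.
  by move=> AP; apply: filterS2 _ At AP => s sA AsP st; exact: AsP.
have H : h^-1 *: (((fun s => u s ord0 i) \o shift t) (h *: 1) - u t ord0 i)
    @[h --> 0^'] --> (d ord0 i : R^o).
  have := cvg_comp _ _ (@shift_dnbhs _ t) ud.
  apply: cvg_trans; apply: near_eq_cvg; near=> h.
  by rewrite /= addrK /GRing.scale/= mulr1.
apply: DeriveDef; first by apply/cvg_ex; exists (d ord0 i).
exact: cvg_lim H.
Unshelve. all: by end_near. Qed.

(** [u s = (s - t) * quotient + u t] off [t], and the quotient converges.  This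
    gives continuity at the endpoints too, where there is no two-sided
    derivative. *)
Lemma is_derive_within_continuous (R : realType) (m : nat) (A : set R)
    (u : R -> 'rV[R]_m) (du : R -> 'rV[R]_m) (i : 'I_m) :
  (forall t, A t -> is_derive_within A u t (du t)) ->
  {within A, continuous (fun s => u s ord0 i)}.
Proof.
move=> ud; apply/subspace_continuousP => t At.
have {}ud := is_derive_within_coord _ _ _ _ _ _ i (ud t At).
have st : s - t @[s --> within A t^'] --> 0.
  rewrite -(subrr t); apply: cvg_within_filter; apply: cvg_within_filter.
  by apply: cvgB; [exact: cvg_id|exact: cvg_cst].
have := cvgD (cvgM st ud) (cvg_cst (u t ord0 i)).
rewrite mul0r add0r => ut P /[dup] /nbhs_singleton /= Put /ut.
(* Both filters unfolded, to compare punctured and full neighbourhoods. *)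
change (nbhs t [set s | s != t -> A s -> P ((s - t) *
    ((s - t)^-1 * (u s ord0 i - u t ord0 i)) + u t ord0 i)] ->
  nbhs t [set s | A s -> P (u s ord0 i)]).
apply: filterS => s /= sP sA.
have [->//|st'] := eqVneq s t.
by have := sP st' sA; rewrite mulrA divff ?subr_eq0// mul1r subrK.
Qed.

(** * Gronwall's inequality *)

(** The function [h s = g s * exp (- L (s - a)) - e (s - a)] is nonincreasing:
    its derivative is [(g' - L g) exp (- L (s - a)) - e], which is at most
    [e exp (- L (s - a)) - e <= 0].  The conclusion is [h t <= h a]. *)
Lemma ler_gronwall (R : realType) (a b L e : R) (g dg : R -> R) : 0 <= L ->
  0 <= e -> {within `[a, b], continuous g} ->
  (forall t, t \in `]a, b[ -> is_derive t 1 g (dg t)) ->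
  (forall t, t \in `]a, b[ -> dg t <= L * g t + e) ->
  forall t, t \in `[a, b] -> g t <= (g a + e * (t - a)) * expR (L * (t - a)).
Proof.
move=> L0 e0 gc gd dgle t tab.
pose h s := g s * expR (- L * (s - a)) - e * (s - a).
have hd s : s \in `]a, b[ ->
    is_derive s 1 h ((dg s - L * g s) * expR (- L * (s - a)) - e).
  move=> sab; have gs := gd s sab.
  pose E s := expR (- L * (s - a)).
  have Ed : is_derive s 1 E (expR (- L * (s - a)) * - L).
    apply: (is_derive1_comp (f := expR) (g := fun s => - L * (s - a))).
    by apply: is_derive_eq; rewrite /GRing.scale/= subr0 mulr1.
  have ld := is_deriveB (is_derive_id s 1) (is_derive_cst a s 1).
  have := is_deriveB (is_deriveM gs Ed) (is_deriveM (is_derive_cst e s 1) ld).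
  by move=> H; apply: is_derive_eq; rewrite /E/GRing.scale/=; ring.
have hc : {within `[a, b], continuous h}.
  have lc : continuous (fun s : R => s - a).
    by move=> s; apply: cvgB; [exact: cvg_id|exact: cvg_cst].
  have Ec : {within `[a, b], continuous (fun s => expR (- L * (s - a)))}.
    apply: continuous_subspaceT => s; apply: continuous_comp.
      by apply: cvgM; [exact: cvg_cst|exact: lc].
    exact: continuous_expR.
  have elc : {within `[a, b], continuous (fun s => e * (s - a))}.
    apply: continuous_subspaceT => s.
    by apply: cvgM; [exact: cvg_cst|exact: lc].
  by move=> s; apply: cvgB; [apply: cvgM; [exact: gc|exact: Ec]|exact: elc].
have aab : a \in `[a, b].
  by move: tab; rewrite !in_itv/= lexx/= => /andP[]; exact: le_trans.
have at_ : a <= t by move: tab; rewrite in_itv/= => /andP[].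
have : h t <= h a.
  apply: (ler0_derive1_le_cc _ _ hc) => // s sab.
    by case: (hd s sab).
  rewrite derive1E; case: (hd s sab) => _ ->; rewrite subr_le0.
  have s_ge : a <= s by move: sab; rewrite in_itv/= => /andP[/ltW].
  have : (dg s - L * g s) * expR (- L * (s - a)) <= e * expR (- L * (s - a)).
    by rewrite ler_wpM2r ?expR_ge0// lerBlDl dgle.
  move=> /le_trans; apply; rewrite ler_piMr// -expR0 ler_expR.
  by rewrite mulNr oppr_le0 mulr_ge0// subr_ge0.
rewrite /h subrr mulr0 expR0 !mulr1 mulr0 subr0 lerBlDr.
by rewrite mulNr expRN ler_pdivrMr// expR_gt0.
Qed.

(** [|w|] may vanish and is then not differentiable; [g := sqrt (|w|^2 + eta^2)]
    is smooth and positive, and [g' = <w, w'> / g <= L g + e] because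
    [|w| <= g].  Moreover [g <= |w| + eta], so that [ler_gronwall] for [g] gives
    the bound up to an error proportional to [eta]. *)
Lemma enorm_gronwall (R : realType) (m : nat) (a b L e : R)
    (w dw : R -> 'rV[R]_m) : 0 <= L -> 0 <= e ->
  (forall i, {within `[a, b], continuous (fun s => w s ord0 i)}) ->
  (forall t i, t \in `]a, b[ ->
    is_derive t 1 (fun s => w s ord0 i) (dw t ord0 i)) ->
  (forall t, t \in `]a, b[ ->
    \sum_(i < m) w t ord0 i * dw t ord0 i
      <= enorm (w t) * (L * enorm (w t) + e)) ->
  forall t, t \in `[a, b] ->
    enorm (w t) <= (enorm (w a) + e * (t - a)) * expR (L * (t - a)).
Proof.
move=> L0 e0 wc wd wdw t tab; apply/ler_addgt0Pr => k k0.
(* With this choice the error [eta * exp (L (t - a))] is exactly [k]. *)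
pose eta := k / expR (L * (t - a)).
have eta0 : 0 < eta by rewrite divr_gt0// expR_gt0.
pose q s := \sum_(i < m) w s ord0 i ^+ 2 + eta ^+ 2.
have q0 s : 0 < q s by rewrite ltr_wpDl ?sumr_sqr_ge0// exprn_gt0.
pose g s := Num.sqrt (q s).
have g0 s : 0 < g s by rewrite sqrtr_gt0.
have ng s : enorm (w s) <= g s.
  by rewrite ler_wsqrtr// lerDl sqr_ge0.
have gn s : g s <= enorm (w s) + eta.
  have p0 : 0 <= enorm (w s) + eta by rewrite addr_ge0 ?enorm_ge0// ltW.
  rewrite -(ger0_norm p0) -sqrtr_sqr ler_wsqrtr// /q sqrrD -enorm_sqr lerD2r.
  by rewrite lerDl mulrn_wge0// mulr_ge0 ?enorm_ge0// ltW.
have gc : {within `[a, b], continuous g}.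
  apply/subspace_continuousP => s sab.
  apply: continuous_cvg; first exact: sqrt_continuous.
  apply: cvgD; last exact: cvg_cst.
  apply: cvg_big => [|i _]; first exact: add_continuous.
  have wcs : w x ord0 i @[x --> within `[a, b] (nbhs s)] --> w s ord0 i.
    exact: (proj1 (subspace_continuousP _ _) (wc i)).
  by rewrite expr2; under eq_fun do rewrite expr2; exact: cvgM.
have gd s : s \in `]a, b[ ->
    is_derive s 1 g ((g s)^-1 * \sum_(i < m) w s ord0 i * dw s ord0 i).
  move=> sab.
  have sd := is_derive_sum (fun i => is_deriveX 2 (wd s i sab)).
  have qd : is_derive s 1 q (2 * \sum_(i < m) w s ord0 i * dw s ord0 i).
    have := is_deriveD sd (is_derive_cst (eta ^+ 2) s 1).
    have -> : \sum_(i < m) (fun s => w s ord0 i) ^+ 2 + cst (eta ^+ 2) = q.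
      by apply/funext => x; rewrite /q /= fctE fct_sumE.
    move=> H; apply: is_derive_eq; rewrite addr0 mulr_sumr.
    by apply: eq_bigr => i _; rewrite /GRing.scale/= expr1 mulrA.
  have := is_derive1_comp (is_derive1_sqrt (q0 s)) qd.
  move=> H; apply: is_derive_eq; rewrite -/(g s) invfM mulrACA.
  by rewrite mulrA mulVf// mul1r.
have gle s : s \in `]a, b[ ->
    (g s)^-1 * \sum_(i < m) w s ord0 i * dw s ord0 i <= L * g s + e.
  move=> sab; rewrite ler_pdivrMl//; apply: le_trans (wdw s sab) _.
  apply: ler_pM; rewrite ?enorm_ge0// ?addr_ge0 ?mulr_ge0 ?enorm_ge0//.
  by rewrite lerD2r ler_wpM2l.
have gt := ler_gronwall _ _ _ _ _ _ _ L0 e0 gc gd gle t tab.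
apply: le_trans (ng t) (le_trans gt _).
have -> : k = eta * expR (L * (t - a)) by rewrite divfK// gt_eqF ?expR_gt0.
by rewrite -mulrDl ler_wpM2r ?expR_ge0// addrAC lerD2r gn.
Qed.

(** * Stability of the latent dynamics *)

Theorem mainTheorem3 (R : realType) (n Nh nmu : nat) (n_lt_Nh : (n < Nh)%N)
    (t0 T : R) (t0_lt_T : t0 < T)
    (P : set 'rV[R]_nmu) (P_compact : compact P)
    (u0h : 'rV[R]_nmu -> 'rV[R]_Nh)
    (fn : R -> 'rV[R]_n -> 'rV[R]_nmu -> 'rV[R]_n)
    (fn_continuous :
       {within [set x : R * 'rV[R]_n * 'rV[R]_nmu |
                  x.1.1 \in `]t0, T] /\ P x.2],
          continuous (fun x : R * 'rV[R]_n * 'rV[R]_nmu =>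
                        fn x.1.1 x.1.2 x.2)})
    (fn_bounded : exists M : R, forall t x nu,
       t \in `]t0, T] -> P nu -> enorm (fn t x nu) <= M)
    (mu : 'rV[R]_nmu) (mu_in_P : P mu)
    (Psi : 'rV[R]_Nh -> 'rV[R]_n) (Psi' : 'rV[R]_n -> 'rV[R]_Nh)
    (LPsi LPsi' Lf : R)
    (Psi_lip : lip_const LPsi Psi)
    (Psi'_lip : lip_const LPsi' Psi')
    (fn_lip : forall t, t \in `]t0, T] -> lip_const Lf (fun x => fn t x mu))
    (un : R -> 'rV[R]_n) (uh : R -> 'rV[R]_Nh)
    (un_sol : ivp_solution t0 T (fun t x => fn t x mu) (Psi (u0h mu)) un)
    (uh_def : forall t, t \in `]t0, T] -> uh t = Psi' (un t)) :
  let C := LPsi' * (LPsi + `|T - t0|) * expR (Lf * `|T - t0|) in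
  forall (eps : R) (delta0 : 'rV[R]_Nh) (delta : R -> 'rV[R]_n)
    (zn : R -> 'rV[R]_n) (zh : R -> 'rV[R]_Nh),
    0 < eps ->
    enorm delta0 < eps ->
    (forall t, t \in `]t0, T] -> enorm (delta t) < eps) ->
    ivp_solution t0 T (fun t x => fn t x mu + delta t)
      (Psi (u0h mu + delta0)) zn ->
    (forall t, t \in `]t0, T] -> zh t = Psi' (zn t)) ->
    forall t, t \in `]t0, T] -> enorm (zh t - uh t) <= C * eps.
Proof.
move=> C eps delta0 delta zn zh eps0 delta0_lt delta_lt zn_sol zh_def t tT.
case: un_sol => -[du [_ duP]] un_eq un_0.
case: zn_sol => -[dz [_ dzP]] zn_eq zn_0.
have [LPsi0 PsiP] := Psi_lip; have [LPsi'0 Psi'P] := Psi'_lip.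
have [Lf0 _] := fn_lip t tT.
have t0t : t0 <= t by move: tT; rewrite in_itv/= => /andP[/ltW].
have tleT : t <= T by move: tT; rewrite in_itv/= => /andP[].
pose w s := zn s - un s.
pose dw s := fn s (zn s) mu + delta s - fn s (un s) mu.
have wE i : (fun s => w s ord0 i) =
    (fun s => zn s ord0 i) - (fun s => un s ord0 i).
  by apply/funext => s; rewrite /w !mxE.
have wc i : {within `[t0, T], continuous (fun s => w s ord0 i)}.
  rewrite wE => s; apply: cvgB.
    exact: (is_derive_within_continuous _ _ _ _ dz).
  exact: (is_derive_within_continuous _ _ _ _ du).
have oo_oc s : s \in `]t0, T[ -> s \in `]t0, T].
  by rewrite !in_itv/= => /andP[-> /ltW].
have wd s i : s \in `]t0, T[ ->
    is_derive s 1 (fun s => w s ord0 i) (dw s ord0 i).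
  move=> sT; have sint : `[t0, T]%classic° s by rewrite interior_itv.
  have zs := zn_eq s (oo_oc s sT); have us := un_eq s (oo_oc s sT).
  have zd := is_derive_within_interior _ _ _ _ _ _ i sint zs.
  have ud := is_derive_within_interior _ _ _ _ _ _ i sint us.
  have := is_deriveB zd ud.
  by rewrite -wE => H; apply: is_derive_eq; rewrite !mxE.
have wdw s : s \in `]t0, T[ -> \sum_(i < n) w s ord0 i * dw s ord0 i
    <= enorm (w s) * (Lf * enorm (w s) + eps).
  move=> /oo_oc sT; have [_ fP] := fn_lip s sT.
  pose df := fn s (zn s) mu - fn s (un s) mu.
  have -> : \sum_(i < n) w s ord0 i * dw s ord0 i
      = \sum_(i < n) w s ord0 i * df ord0 i
        + \sum_(i < n) w s ord0 i * delta s ord0 i.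
    by rewrite -big_split/=; apply: eq_bigr => i _; rewrite /dw /df !mxE; ring.
  apply: le_trans (lerD (dotmul_le_enorm _ _ _ _) (dotmul_le_enorm _ _ _ _)) _.
  rewrite -mulrDr ler_wpM2l ?enorm_ge0// lerD//; first exact: fP.
  exact/ltW/delta_lt.
have tcc : t \in `[t0, T] by rewrite in_itv/= t0t.
have wt := enorm_gronwall _ _ _ _ _ _ _ _ Lf0 (ltW eps0) wc wd wdw t tcc.
have w0 : enorm (w t0) <= LPsi * eps.
  rewrite /w zn_0 un_0; apply: le_trans (PsiP _ _) _.
  by rewrite addrC addKr ler_wpM2l// ltW.
rewrite zh_def// uh_def//; apply: le_trans (Psi'P _ _) _.
rewrite /C -!mulrA ler_wpM2l//; apply: le_trans wt _.
have T0 : 0 <= T - t0 by rewrite subr_ge0 ltW.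
have tT0 : t - t0 <= T - t0 by rewrite lerD2r.
rewrite ger0_norm// [expR _ * eps]mulrC mulrA.
have t00 : 0 <= t - t0 by rewrite subr_ge0.
apply: ler_pM; rewrite ?expR_ge0//.
- by rewrite addr_ge0 ?enorm_ge0// mulr_ge0// ltW.
- by rewrite mulrDl lerD// mulrC ler_wpM2r// ltW.
- by rewrite ler_expR ler_wpM2l.
Qed.
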